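(* Every compact oriented immersed surface without boundary in the Gaussian space $(\mathbb{R}^3,\delta_{ij},|x|^2/4)$ with constant weighted mean curvature $H_f$ is unstable.
   Context: The Gaussian space is $\mathbb{R}^3$ with the Euclidean metric and the weight function $f(x)=|x|^2/4$. For an isometrically immersed oriented surface $\Sigma$ with globally defined unit normal field $N$: $A$ is the second fundamental form (shape operator $AX=-\overline\nabla_XN$), $|A|$ its Hilbert–Schmidt norm, $H=\mathrm{tr}\,A$ the mean curvature, and $H_f=H+\langle N,\nabla f\rangle$ the weighted mean curvature. Let $\mathrm{Ric}_f=\mathrm{Ric}+\mathrm{Hess}\,f$, let $dv_f=e^{-f}dv$ be the weighted area element of $\Sigma$ ($dv$ the area element), and let $\Delta_fu=\Delta u-\langle\nabla u,\nabla f\rangle$ on $\Sigma$. The weighted Jacobi operator is $J_fu=\Delta_fu+(|A|^2+\mathrm{Ric}_f(N,N))u$ for $u\in C^\infty(\Sigma)$. Its first eigenvalue is $\lambda_1=\inf\left\{\frac{-\int_\Sigma uJ_fu\,dv_f}{\int_\Sigma u^2\,dv_f}: u\in C^\infty(\Sigma),\ u\ne0\right\}$. The surface $\Sigma$ is called stable if $\lambda_1\ge0$, and unstable otherwise. *)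

(* Defs.v *)
From HB Require Import structures.
From mathcomp Require Import all_boot all_order all_algebra.
From mathcomp Require Import all_classical all_reals all_analysis.

Set Implicit Arguments.
Unset Strict Implicit.
Unset Printing Implicit Defensive.

Import Order.TTheory GRing.Theory Num.Theory.
Import numFieldNormedType.Exports.

Local Open Scope classical_set_scope.
Local Open Scope ring_scope.

Fixpoint Ck (R : realType) (V W : normedModType R) (k : nat) (U : set V)
    (h : V -> W) : Prop :=
  if k is k'.+1 then
    (forall x, U x -> differentiable h x) /\ (forall v, Ck k' U ('D_v h))
  else forall x, U x -> {for x, continuous h}.

(* Meaningful for open U, which is the only way it is used. *)
Definition smooth_on (R : realType) (V W : normedModType R) (U : set V)
  (h : V -> W) : Prop := forall k, Ck k U h.

(* G x is the Gram matrix of a Riemannian metric at the coordinate point x. *)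

Section coordinate_geometry.
Context {R : realType} {n : nat}.
Implicit Types (G : 'rV[R]_n -> 'M[R]_n) (u : 'rV[R]_n -> R).

Definition partial (i : 'I_n) u (x : 'rV[R]_n) : R := 'D_(delta_mx 0 i) u x.

(* Gamma^k_{ij} *)
Definition christoffel G (k i j : 'I_n) (x : 'rV[R]_n) : R :=
  2^-1 * \sum_(l < n) invmx (G x) k l *
    (partial i (fun y => G y j l) x + partial j (fun y => G y i l) x
     - partial l (fun y => G y i j) x).

Definition hessian G u (x : 'rV[R]_n) : 'M[R]_n :=
  \matrix_(i < n, j < n)
    (partial i (partial j u) x
     - \sum_(k < n) christoffel G k i j x * partial k u x).

Definition ricci G (x : 'rV[R]_n) : 'M[R]_n :=
  \matrix_(i < n, j < n) \sum_(k < n)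
    (partial k (christoffel G k i j) x - partial j (christoffel G k i k) x
     + \sum_(l < n) (christoffel G k k l x * christoffel G l i j x
                     - christoffel G k j l x * christoffel G l i k x)).

Definition grad G u (x : 'rV[R]_n) : 'rV[R]_n :=
  (\row_(i < n) partial i u x) *m invmx (G x).

Definition laplacian G u (x : 'rV[R]_n) : R :=
  \tr (invmx (G x) *m hessian G u x).

Definition inner (B : 'M[R]_n) (v w : 'rV[R]_n) : R := (v *m B *m w^T) 0 0.

Definition euclidean (x : 'rV[R]_n) : 'M[R]_n := 1%:M.

Definition ricci_weighted (f : 'rV[R]_n -> R) (x : 'rV[R]_n) : 'M[R]_n :=
  ricci euclidean x + hessian euclidean f x.

Definition dot (v w : 'rV[R]_n) : R := inner 1%:M v w.

End coordinate_geometry.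

Definition gaussian_weight (R : realType) (x : 'rV[R]_3) : R := dot x x / 4.

(* The images of charts are open in the whole plane: no boundary. *)

Record chart (R : realType) (M : topologicalType) := Chart {
  cdom : set M;
  cfun : M -> 'rV[R]_2;
  cinv : 'rV[R]_2 -> M;
  cdom_open : open cdom;
  cimg_open : open (cfun @` cdom);
  cfunK : forall p, cdom p -> cinv (cfun p) = p;
  cfun_cont : forall p, cdom p -> {for p, continuous cfun};
  cinv_cont : forall p, cdom p -> {for cfun p, continuous cinv} }.

Definition transition (R : realType) (M : topologicalType) (c d : chart R M)
  : 'rV[R]_2 -> 'rV[R]_2 := cfun d \o cinv c.

Record surface (R : realType) := Surface {
  surface_sort :> topologicalType;
  surface_hausdorff : hausdorff_space surface_sort;
  surface_countable : @second_countable surface_sort;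
  atlas : set (chart R surface_sort);
  atlas_cover : forall p, exists2 c, atlas c & cdom c p;
  atlas_smooth : forall c d, atlas c -> atlas d ->
    smooth_on (cfun c @` (cdom c `&` cdom d)) (transition c d) }.

Record compact_surface (R : realType) := CompactSurface {
  compact_surface_sort :> surface R;
  surface_compact : compact [set: compact_surface_sort] }.

Definition oriented (R : realType) (S : surface R) : Prop :=
  forall c d : chart R S, atlas c -> atlas d ->
  forall p, cdom c p -> cdom d p -> 0 < \det ('J (transition c d) (cfun c p)).

Section surfaces.
Context {R : realType} (S : surface R).

Definition chart_at (p : S) : chart R S := projT1 (cid2 (atlas_cover p)).

Lemma chart_at_atlas p : atlas (chart_at p).
Proof. by rewrite /chart_at; case: cid2. Qed.

Lemma chart_at_dom p : cdom (chart_at p) p.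
Proof. by rewrite /chart_at; case: cid2. Qed.

Definition smooth (W : normedModType R) (u : S -> W) : Prop :=
  forall c, atlas c -> smooth_on (cfun c @` cdom c) (u \o cinv c).

Definition immersion (X : S -> 'rV[R]_3) : Prop :=
  smooth X /\
  forall c p, atlas c -> cdom c p ->
    injective ('d (X \o cinv c) (cfun c p)).

(* In the library's row-vector convention the rows of 'J (X \o cinv c) q are
   the coordinate tangent vectors of the immersion X. *)
Definition unit_normal (X N : S -> 'rV[R]_3) : Prop :=
  [/\ smooth N, (forall p, dot (N p) (N p) = 1) &
      forall c p, atlas c -> cdom c p ->
        'J (X \o cinv c) (cfun c p) *m (N p)^T = 0].

(* first fundamental form <d_i X, d_j X> and second fundamental form
   <A d_i X, d_j X> = - <d_i N, d_j X>, in the chart c *)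
Definition first_form (X : S -> 'rV[R]_3) (c : chart R S) (q : 'rV[R]_2)
    : 'M[R]_2 :=
  'J (X \o cinv c) q *m ('J (X \o cinv c) q)^T.

Definition second_form (X N : S -> 'rV[R]_3) (c : chart R S) (q : 'rV[R]_2)
    : 'M[R]_2 :=
  - ('J (N \o cinv c) q *m ('J (X \o cinv c) q)^T).

(* The quantities below do not depend on the chart; they are computed in the
   chart [chart_at p]. *)

(* matrix of A, with A d_i X = \sum_j (shape_operator i j) d_j X *)
Definition shape_operator (X N : S -> 'rV[R]_3) (p : S) : 'M[R]_2 :=
  let c := chart_at p in let q := cfun c p in
  second_form X N c q *m invmx (first_form X c q).

(* |A|^2 = \tr (A A^* ), with A^* the adjoint for the induced metric g, whose
   matrix in the same convention is g (shape_operator)^T g^-1 *)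
Definition norm_shape_sqr (X N : S -> 'rV[R]_3) (p : S) : R :=
  let c := chart_at p in
  let g := first_form X c (cfun c p) in let A := shape_operator X N p in
  \tr (A *m (g *m A^T *m invmx g)).

Definition mean_curvature (X N : S -> 'rV[R]_3) (p : S) : R :=
  \tr (shape_operator X N p).

Definition weighted_mean_curvature (f : 'rV[R]_3 -> R) (X N : S -> 'rV[R]_3)
    (p : S) : R :=
  mean_curvature X N p + dot (N p) (grad euclidean f (X p)).

(* gradients and Laplacian are those of the metric induced by X on S *)
Definition drift_laplacian (f : 'rV[R]_3 -> R) (X : S -> 'rV[R]_3)
    (u : S -> R) (p : S) : R :=
  let c := chart_at p in let q := cfun c p in let g := first_form X c in
  laplacian g (u \o cinv c) q
  - inner (g q) (grad g (u \o cinv c) q) (grad g (f \o X \o cinv c) q).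

Definition jacobi (f : 'rV[R]_3 -> R) (X N : S -> 'rV[R]_3) (u : S -> R)
    (p : S) : R :=
  drift_laplacian f X u p
  + (norm_shape_sqr X N p + inner (ricci_weighted f (X p)) (N p) (N p)) * u p.

End surfaces.

(* Integration on a compact surface: the surface is cut into finitely many
    disjoint Borel pieces, each contained in a compact subset of a chart
    domain, and the area element is written in coordinates on every piece.  By
    the change of variables formula the result does not depend on the cut. *)

Record cut (R : realType) (S : surface R) := Cut {
  cut_size : nat;
  cut_chart : 'I_cut_size -> chart R S;
  cut_set : 'I_cut_size -> set S;
  cut_atlas : forall i, atlas (cut_chart i);
  cut_compact : forall i, compact (cut_set i);
  cut_dom : forall i, cut_set i `<=` cdom (cut_chart i);
  cut_cover : forall p, exists i, cut_set i p }.

Definition cut_piece (R : realType) (S : surface R) (D : cut S)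
    (i : 'I_(cut_size D)) : set S :=
  cut_set i `\` \bigcup_(j in [set j : 'I_(cut_size D) | (j < i)%N]) cut_set j.

Lemma compact_chart_nbhs (R : realType) (S : surface R) (p : S) :
  exists K : set S, [/\ compact K, K `<=` cdom (chart_at p) & nbhs p K].
Proof.
set c := chart_at p; have cp : cdom c p := chart_at_dom p.
have : nbhs (cfun c p) (cfun c @` cdom c).
  by apply: open_nbhs_nbhs; split; [exact: cimg_open | exists p].
move=> /nbhs_closedballP [r rB].
set B := closed_ball _ _ in rB.
have cB : compact B.
  apply: bounded_closed_compact; last exact: closed_ball_closed.
  exists (`|cfun c p| + r%:num); split; first exact: num_real.
  move=> M rM y; rewrite /B closed_ballE // /closed_ball_ /= => py.
  rewrite -[y](subrK (cfun c p)) addrC ltW// (le_lt_trans _ rM)//.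
  by rewrite (le_trans (ler_normD _ _))// lerD2l distrC.
exists (cinv c @` B); split.
- apply: continuous_compact => //.
  apply/continuous_in_subspaceT => y /[1!inE] /rB [q cq <-].
  exact: cinv_cont.
- by move=> _ [y /rB [q cq <-] <-]; rewrite cfunK.
- have np : nbhs p (cfun c @^-1` B).
    by apply: cfun_cont => //; apply/nbhs_closedballP; exists r.
  have cn : nbhs p (cdom c).
    by apply: open_nbhs_nbhs; split => //; exact: cdom_open.
  apply: filterS (filterI np cn) => q [Bq cq].
  by exists (cfun c q) => //; rewrite cfunK.
Qed.

Lemma cut_exists (R : realType) (S : compact_surface R) :
  exists D : cut S, True.
Proof.
pose K (p : S) := projT1 (cid (compact_chart_nbhs p)).
have [cK KD Kn] : [/\ forall p, compact (K p),
    forall p, K p `<=` cdom (chart_at p) & forall p, nbhs p (K p)].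
  by split=> p; rewrite /K; case: cid => /= A [].
pose F : set_system (seq S) :=
  filter_from setT (fun s : seq S => [set t : seq S | {subset s <= t}]).
have FF : Filter F.
  apply: filter_from_filter; first by exists [::].
  move=> s t _ _; exists (s ++ t) => // w stw; split=> x xs; apply: stw;
    by rewrite mem_cat xs ?orbT.
have /compact_near_coveringP := surface_compact (c := S).
move=> /(_ _ F (fun s x => exists2 p, p \in s & K p x) FF) [|s _ sC].
  move=> x _; exists (K x, [set t : seq S | x \in t]) => /=.
    split=> //; exists [:: x] => // t; apply; exact: mem_head.
  by move=> [y t] /= [Ky xt]; exists x.
pose n := size s.
have sK p : exists i : 'I_n, K (tnth (in_tuple s) i) p.
  have [//|q qs Kq] := sC s _ p I.
  have qn : (index q s < n)%N by rewrite index_mem.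
  by exists (Ordinal qn); rewrite (tnth_nth p) /= nth_index.
by exists (Cut (fun i : 'I_n => chart_at_atlas (tnth (in_tuple s) i))
  (fun i => cK _) (fun i => KD _) sK).
Qed.

Definition row2 (R : realType) (z : R * R) : 'rV[R]_2 :=
  \row_(i < 2) if i == 0 then z.1 else z.2.

Definition integral_plane (R : realType) (A : set 'rV[R]_2)
    (h : 'rV[R]_2 -> R) : R :=
  \int[(lebesgue_measure \x lebesgue_measure)%E]_(z in @row2 R @^-1` A)
    h (row2 z).

Section integration.
Context {R : realType} (S : compact_surface R).

Definition the_cut : cut S := projT1 (cid (cut_exists S)).

(* \int_S F dv, where dv = sqrt (det g) dq in coordinates *)
Definition integral_surface (X : S -> 'rV[R]_3) (F : S -> R) : R :=
  \sum_(i < cut_size the_cut)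
    let c := cut_chart i in
    integral_plane (cfun c @` cut_piece i)
      (fun q => F (cinv c q) * Num.sqrt (\det (first_form X c q))).

Definition integral_weighted (f : 'rV[R]_3 -> R) (X : S -> 'rV[R]_3)
    (F : S -> R) : R :=
  integral_surface X (fun p => F p * expR (- f (X p))).

Definition rayleigh (f : 'rV[R]_3 -> R) (X N : S -> 'rV[R]_3) (u : S -> R)
    : R :=
  - integral_weighted f X (fun p => u p * jacobi f X N u p)
  / integral_weighted f X (fun p => u p ^+ 2).

Definition first_eigenvalue (f : 'rV[R]_3 -> R) (X N : S -> 'rV[R]_3)
    : \bar R :=
  ereal_inf [set (rayleigh f X N u)%:E |
              u in [set u : S -> R | smooth (u : S -> R^o) /\ u <> cst 0]].

Definition stable (f : 'rV[R]_3 -> R) (X N : S -> 'rV[R]_3) : Prop :=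
  (0%:E <= first_eigenvalue f X N)%E.

Definition unstable (f : 'rV[R]_3 -> R) (X N : S -> 'rV[R]_3) : Prop :=
  ~ stable f X N.

End integration.

(* Main.v *)
(** The test function 1 already has a negative Rayleigh quotient: since
    Hess f = 1/2 on the Gaussian space, J_f 1 = |A|^2 + 1/2 > 0.  The integrals
    of positive continuous functions over the closed surface are positive and
    finite.  Continuity of |A|^2, which is defined through an arbitrary choice
    of chart at each point, comes from its invariance under changes of chart. *)

Require Import Defs.
From mathcomp Require Import all_boot all_order all_algebra.
From mathcomp Require Import all_classical all_reals all_analysis.
From mathcomp Require Import ring lra.

Set Implicit Arguments.
Unset Strict Implicit.
Unset Printing Implicit Defensive.

Import Order.TTheory GRing.Theory Num.Theory.
Import numFieldNormedType.Exports.

Local Open Scope classical_set_scope.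
Local Open Scope ring_scope.

(** * Positivity of integrals over possibly non-measurable sets *)

(** Monotonicity for sets and functions that may fail to be measurable: the integral of a
    nonnegative function is a supremum over the nonnegative simple functions below it, and a larger
    function has more of these. *)
Lemma integral_le_nonneg d (T : measurableType d) (R : realType)
    (mu : {measure set T -> \bar R}) (D1 D2 : set T) (f1 f2 : T -> \bar R) :
  (forall x, 0 <= (f1 \_ D1) x)%E ->
  (forall x, (f1 \_ D1) x <= (f2 \_ D2) x)%E ->
  (\int[mu]_(x in D1) f1 x <= \int[mu]_(x in D2) f2 x)%E.
Proof.
move=> f1_ge0 f12; rewrite (integral_mkcond D1) (integral_mkcond D2).
rewrite !ge0_integralTE//; last by move=> x; exact: le_trans (f12 x).
apply: le_ereal_sup => _ [h hf1 <-]; exists h => // x.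
exact: le_trans (f12 x).
Qed.

(** The set [D] and the function [h] may be non-measurable; the integral over [D] is squeezed
    between [a * mu B] and [b * mu A], with [A] and [B] measurable. *)
Lemma Rintegral_gt0 d (T : measurableType d) (R : realType)
    (mu : {measure set T -> \bar R}) (A B D : set T) (a b : R) (h : T -> R) :
  measurable A -> measurable B -> B `<=` D -> D `<=` A ->
  (0 < mu B)%E -> (mu A < +oo)%E -> 0 < a ->
  (forall x, D x -> 0 <= h x <= b) -> (forall x, B x -> a <= h x) ->
  0 < \int[mu]_(x in D) h x.
Proof.
(* [Rintegral] is [fine] of an extended real, and [fine] sends [+oo] to 0, so finiteness must be
   shown along with positivity. *)
move=> mA mB BD DA B0 Aoo a0 hb ha; rewrite /Rintegral; apply: fine_gt0.
apply/andP; split.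
  apply: (@lt_le_trans _ _ (\int[mu]_(x in B) a%:E)%E).
    by rewrite integral_cst// mule_gt0.
  apply: integral_le_nonneg => x; rewrite /patch.
    by case: ifP => // _; rewrite lee_fin ltW.
  case: ifPn => [/[!inE] Bx|_].
    by rewrite mem_set ?lee_fin; [exact: ha|exact: BD].
  by case: ifPn => // /[!inE] /hb/andP[h0 _]; rewrite lee_fin.
(* A point of [B] yields [0 <= b], which is used both on [A] outside [D] and for the finiteness of
   [b * mu A]. *)
have [x0 Bx0] : B !=set0.
  by apply/set0P/eqP => B_0; move: B0; rewrite B_0 measure0 ltxx.
have b0 : 0 <= b by have /andP[] := hb x0 (BD _ Bx0); exact: le_trans.
apply: (@le_lt_trans _ _ (\int[mu]_(x in A) b%:E)%E); last first.
  by rewrite integral_cst// lte_mul_pinfty.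
apply: integral_le_nonneg => x; rewrite /patch.
  by case: ifPn => // /[!inE] /hb/andP[]; rewrite lee_fin.
case: ifPn => [/[!inE] Dx|_].
  by rewrite mem_set ?lee_fin; [have /andP[] := hb x Dx|exact: DA].
by case: ifPn => // _; rewrite lee_fin.
Qed.

(** The squeeze above, with a closed square containing [D] as outer set and an open square around
    [q] as inner set. *)
Lemma integral_plane_gt0 (R : realType) (D : set 'rV[R]_2) (q : 'rV[R]_2)
    (a b M : R) (h : 'rV[R]_2 -> R) :
  D `<=` [set y | `|y| <= M] ->
  0 < a -> (forall y, D y -> 0 <= h y <= b) ->
  (\forall y \near q, D y /\ a <= h y) ->
  0 < integral_plane D h.
Proof.
move=> DM a0 hb /nbhs_ballP[e e0 Dq].
have entry (y : 'rV[R]_2) j : `|y 0 j| <= `|y|.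
  rewrite [leRHS](_ : _ = mx_norm y)// mx_normrE; apply/bigmax_geP; right.
  by exists (0, j).
pose I j := `]q 0 j - e, q 0 j + e[%classic : set R.
pose J := `[- M, M]%classic : set R.
rewrite /integral_plane.
(* The norm on row vectors is the sup norm, so this open square lies in the ball of radius [e]. *)
have IB : I 0 `*` I 1 `<=` @row2 R @^-1` ball q e.
  move=> [x y]/= [] /= Ix Iy.
  rewrite mx_norm_ball /ball_/= [ltLHS](mx_normrE (q - row2 (x, y))).
  apply/bigmax_ltP; split=> //= -[i j] _ /=; rewrite ord1 !mxE.
  rewrite ltr_distlC; case: j => -[|[|//]] lj /=.
  - by rewrite (_ : Ordinal lj = 0) ?eqxx//; apply/val_inj.
  - by rewrite (_ : Ordinal lj = 1)//; apply/val_inj.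
apply: (@Rintegral_gt0 _ _ R
  [the measure _ _ of (lebesgue_measure \x lebesgue_measure)%E]
  (J `*` J) (I 0 `*` I 1) (@row2 R @^-1` D) a b (h \o @row2 R)) => //.
- by apply: measurableX; exact: measurable_itv.
- by apply: measurableX; exact: measurable_itv.
- by move=> z /IB/Dq[].
- move=> z /DM /= zM; split; rewrite /J/= in_itv/= -ler_norml.
  + by apply: le_trans (le_trans (entry _ 0) zM); rewrite mxE.
  + by apply: le_trans (le_trans (entry _ 1) zM); rewrite mxE.
- rewrite [ltRHS](_ : _ =
      lebesgue_measure (I 0%R) * lebesgue_measure (I 1%R))%E.
    rewrite /I !lebesgue_measure_itv/= !lte_fin.
    rewrite !ifT; [|by rewrite ltrBlDr -addrA ltrDl addr_gt0..].
    rewrite -!EFinB -EFinM lte_fin mulr_gt0// subr_gt0 ltrBlDr -addrA.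
      by rewrite ltrDl addr_gt0.
    by rewrite ltrDl addr_gt0.
  by apply: product_measure1E; exact: measurable_itv.
- rewrite [ltLHS](_ : _ = lebesgue_measure J * lebesgue_measure J)%E.
    rewrite lebesgue_measure_itv/=; case: ifP => _.
      by rewrite -?EFinB -?EFinM ltry.
    by rewrite mul0e ltry.
  by apply: product_measure1E; exact: measurable_itv.
- by move=> z /hb.
- by move=> z /IB/Dq[].
Qed.

(** * Continuity of matrix-valued maps *)

Lemma near_eq_continuous (T U : topologicalType) (f g : T -> U) (x : T) :
  {near x, f =1 g} -> {for x, continuous f} -> {for x, continuous g}.
Proof.
move=> fg fx; rewrite /prop_for /continuous_at -(nbhs_singleton fg).
by apply: cvg_trans fx; exact: near_eq_cvg.
Qed.

Section matrix_continuity.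
Context {R : realType} {T : topologicalType} {x : T}.

Lemma continuous_mx m n (f : T -> 'M[R]_(m, n)) :
  {for x, continuous f} <->
  (forall i j, {for x, continuous (fun y => f y i j)}).
Proof.
split=> [cf i j|cf].
  exact: continuous_comp cf (@coord_continuous _ _ _ i j _).
apply/cvg_ballP => e e0.
have : \forall y \near x, forall i j, ball (f x i j) e (f y i j).
  apply: filter_forall => i; apply: filter_forall => j.
  by have /cvg_ballP := cf i j; exact.
by apply: filterS => y fy; split.
Qed.

Lemma continuous_mulmx m n p (f : T -> 'M[R]_(m, n)) (g : T -> 'M[R]_(n, p)) :
  {for x, continuous f} -> {for x, continuous g} ->
  {for x, continuous (fun y => f y *m g y)}.
Proof.
move=> /continuous_mx cf /continuous_mx cg; apply/continuous_mx => i j.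
rewrite /prop_for /continuous_at; under eq_fun do rewrite mxE; rewrite mxE.
apply: cvg_big => [|k _]; first exact: add_continuous.
by apply: cvgM; [exact: cf|exact: cg].
Qed.

Lemma continuous_trmx m n (f : T -> 'M[R]_(m, n)) :
  {for x, continuous f} -> {for x, continuous (fun y => (f y)^T)}.
Proof.
move=> /continuous_mx cf; apply/continuous_mx => i j.
rewrite /prop_for /continuous_at; under eq_fun do rewrite mxE; rewrite mxE.
exact: cf.
Qed.

Lemma continuous_mxtrace n (f : T -> 'M[R]_n) :
  {for x, continuous f} -> {for x, continuous (fun y => \tr (f y))}.
Proof.
move=> /continuous_mx cf; rewrite /mxtrace.
by apply: cvg_big => [|k _]; [exact: add_continuous|exact: cf].
Qed.

Lemma continuous_det n (f : T -> 'M[R]_n) :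
  {for x, continuous f} -> {for x, continuous (fun y => \det (f y))}.
Proof.
move=> /continuous_mx cf; rewrite /determinant.
apply: cvg_big => [|s _]; first exact: add_continuous.
apply: cvgM; first exact: cvg_cst.
by apply: cvg_big => [|k _]; [exact: mul_continuous|exact: cf].
Qed.

Lemma continuous_invmx n (f : T -> 'M[R]_n) :
  f x \in unitmx -> {for x, continuous f} ->
  {for x, continuous (fun y => invmx (f y))}.
Proof.
move=> uf cf; have df : \det (f x) != 0 by rewrite -unitfE -unitmxE.
have cdet := continuous_det cf.
(* [invmx] returns a singular matrix unchanged, so the adjugate formula is available only where the
   determinant is nonzero, which holds near [x]. *)
apply: (@near_eq_continuous _ _ (fun y => (\det (f y))^-1 *: \adj (f y))).
  near=> y; rewrite /invmx ifT// unitmxE unitfE.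
  by near: y; exact: (cvgr_neq0 _ cdet df).
apply/continuous_mx => i j.
rewrite /prop_for /continuous_at; under eq_fun do rewrite !mxE; rewrite !mxE.
apply: cvgM; first exact: cvgV.
apply: cvgM; first exact: cvg_cst.
apply: continuous_det; apply/continuous_mx => k l.
rewrite /prop_for /continuous_at; under eq_fun do rewrite !mxE; rewrite !mxE.
by move/continuous_mx : cf; apply.
Unshelve. all: by end_near. Qed.

End matrix_continuity.

(** * Gram matrices and traces of bilinear forms *)

Section gram.
Context {R : realType}.

Lemma mxtrace_gram_ge0 m n (B : 'M[R]_(m, n)) : 0 <= \tr (B *m B^T).
Proof.
apply: sumr_ge0 => i _; rewrite mxE; apply: sumr_ge0 => j _.
by rewrite mxE -expr2 sqr_ge0.
Qed.

Lemma gram_eq0 n (v : 'rV[R]_n) : v *m v^T = 0 -> v = 0.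
Proof.
move/matrixP/(_ 0 0); rewrite !mxE => /eqP.
rewrite psumr_eq0 => [/allP v0|i _]; last by rewrite mxE -expr2 sqr_ge0.
apply/rowP => i; have := v0 i; rewrite mem_index_enum => /(_ isT).
by rewrite !mxE mulf_eq0 orbb => /eqP.
Qed.

(** If v J J^T = 0 then (v J)(v J)^T = 0, hence v J = 0 and v = 0. The argument is run on each row
    of the kernel matrix. *)
Lemma gram_unitmx m n (J : 'M[R]_(m, n)) :
  (forall v : 'rV_m, v *m J = 0 -> v = 0) -> J *m J^T \in unitmx.
Proof.
move=> J0; rewrite -row_free_unit -kermx_eq0; apply/eqP/row_matrixP => i.
rewrite row0; apply: J0; apply: gram_eq0.
have := mulmx_ker (J *m J^T); set k := kermx _ => /(congr1 (row i)).
rewrite row_mul row0 => ik.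
by rewrite trmx_mul mulmxA -(mulmxA _ J) ik mul0mx.
Qed.

Lemma det_mx22 (A : 'M[R]_2) : \det A = A 0 0 * A 1 1 - A 0 1 * A 1 0.
Proof.
rewrite (expand_det_row _ 0) !big_ord_recl big_ord0 /cofactor !det_mx11 !mxE/=.
rewrite addr0 expr0 expr1 mul1r mulN1r mulrN.
by congr (_ * A _ _ - A _ _ * A _ _); apply/val_inj.
Qed.

Lemma det_gram_gt0 (J : 'M[R]_(2, 3)) :
  (forall v : 'rV_2, v *m J = 0 -> v = 0) -> 0 < \det (J *m J^T).
Proof.
move=> J0; rewrite lt_neqAle; apply/andP; split.
  by rewrite eq_sym -unitfE -unitmxE gram_unitmx.
rewrite det_mx22 !mxE !big_ord_recl !big_ord0 !mxE.
set a := J 0 _; set b := J 0 _; set c := J 0 _.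
set x := J 1 _; set y := J 1 _; set z := J 1 _.
(* Lagrange's identity: the Gram determinant is the squared length of the cross product of the two
   rows. *)
rewrite [leRHS](_ : _ = (a * y - b * x) ^+ 2 + (a * z - c * x) ^+ 2
  + (b * z - c * y) ^+ 2); last by ring.
by rewrite !addr_ge0 ?sqr_ge0.
Qed.

Lemma invmxM n (A B : 'M[R]_n) : A \in unitmx -> B \in unitmx ->
  invmx (A *m B) = invmx B *m invmx A.
Proof.
move=> uA uB; have uAB : A *m B \in unitmx by rewrite unitmx_mul uA.
apply: (can_inj (mulKmx uAB)).
by rewrite mulmxV// -mulmxA (mulmxA B) mulmxV// mul1mx mulmxV.
Qed.

(* With [g = J J^T] and [K = g^-1 J] one has [g^-1 = K K^T], so the trace is
   the squared Hilbert-Schmidt norm of [K^T h K]. *)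
Lemma mxtrace_gram_form_ge0 m n (J : 'M[R]_(m, n)) (h : 'M[R]_m) :
  J *m J^T \in unitmx ->
  0 <= \tr (h *m invmx (J *m J^T) *m h^T *m invmx (J *m J^T)).
Proof.
move=> ug; set g := J *m J^T in ug *.
have [K ->] : exists (K : 'M[R]_(m, n)), invmx g = K *m K^T.
  exists (invmx g *m J).
  rewrite trmx_mul trmx_inv trmx_mul trmxK mulmxA -(mulmxA _ J) -/g.
  by rewrite mulVmx// mul1mx.
rewrite !mulmxA mxtrace_mulC !mulmxA.
rewrite (_ : _ *m K = K^T *m h *m K *m (K^T *m h *m K)^T); last first.
  by rewrite !trmx_mul trmxK !mulmxA.
exact: mxtrace_gram_ge0.
Qed.

(** In h' g'^-1 the factor P^T cancels, leaving P (h g^-1) P^-1; the same holds for h^T. The product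
    is thus conjugated by P and keeps its trace. *)
Lemma mxtrace_form_congr n (P g h : 'M[R]_n) : P \in unitmx -> g \in unitmx ->
  let g' := P *m g *m P^T in let h' := P *m h *m P^T in
  \tr (h' *m invmx g' *m h'^T *m invmx g') =
  \tr (h *m invmx g *m h^T *m invmx g).
Proof.
move=> uP ug g' h'; have uPT : P^T \in unitmx by rewrite unitmx_tr.
have hg A : P *m A *m P^T *m invmx g' = P *m (A *m invmx g) *m invmx P.
  rewrite !invmxM ?unitmx_mul ?uP// !mulmxA mulmxK//.
have hT : h'^T = P *m h^T *m P^T by rewrite !trmx_mul trmxK mulmxA.
rewrite -mulmxA hT !hg -!mulmxA mulKmx// mxtrace_mulC -!mulmxA mulVmx//.
by rewrite mulmx1.
Qed.

(** The left side has the shape of [norm_shape_sqr], with A = h g^-1. Symmetry of g gives g A^T =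
    h^T, which reduces it to the trace of the previous lemma. *)
Lemma mxtrace_adjoint_congr n (P g h g' h' : 'M[R]_n) :
  g^T = g -> P \in unitmx -> g \in unitmx ->
  g' = P *m g *m P^T -> h' = P *m h *m P^T ->
  \tr (h *m invmx g *m (g *m (h *m invmx g)^T *m invmx g)) =
  \tr (h' *m invmx g' *m h'^T *m invmx g').
Proof.
move=> gT uP ug -> ->; rewrite mxtrace_form_congr//.
by rewrite trmx_mul trmx_inv gT mulKVmx// mulmxA.
Qed.

End gram.

(** * Jacobian matrices in the row-vector convention *)

Section jacobians.
Context {R : realType}.

Lemma row_jacobian m n (h : 'rV[R]_m -> 'rV[R]_n) q i :
  differentiable h q -> row i ('J h q) = 'D_(delta_mx 0 i) h q.
Proof. by move=> hq; rewrite (deriveEjacobian _ hq) rowE. Qed.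

Lemma jacobian_comp m n p (f : 'rV[R]_m -> 'rV[R]_n)
    (g : 'rV[R]_n -> 'rV[R]_p) q :
  differentiable f q -> differentiable g (f q) ->
  'J (g \o f) q = 'J f q *m 'J g (f q).
Proof.
move=> df dg; apply/row_matrixP => i; rewrite row_mul !rowE /jacobian.
by rewrite !mul_rV_lin1 diff_comp.
Qed.

(** The rows are directional derivatives, and these depend only on the germ of the map. *)
Lemma near_eq_jacobian m n (f g : 'rV[R]_m -> 'rV[R]_n) q :
  differentiable f q -> differentiable g q -> {near q, f =1 g} ->
  'J f q = 'J g q.
Proof.
move=> df dg fg; apply/row_matrixP => i.
apply: etrans (row_jacobian i df) _; apply: etrans (esym (row_jacobian i dg)).
exact: near_eq_derive.
Qed.

End jacobians.

(** * Smooth maps read in charts *)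

Section charts.
Context {R : realType} {S : surface R}.
Implicit Types (c d : chart R S) (p : S).

Lemma near_cdom c p : cdom c p -> \forall p' \near p, cdom c p'.
Proof. by move=> cp; apply: open_nbhs_nbhs; split=> //; exact: cdom_open. Qed.

Lemma near_cimg c p : cdom c p ->
  \forall q \near cfun c p, (cfun c @` cdom c) q.
Proof.
by move=> cp; apply: open_nbhs_nbhs; split; [exact: cimg_open|exists p].
Qed.

Lemma cvg_cinv c p : cdom c p -> cinv c q @[q --> cfun c p] --> p.
Proof. by move=> cp; rewrite -{2}(cfunK cp); exact: cinv_cont. Qed.

(** Near a point of the image, [cinv c] is a continuous inverse taking values in [U], and the full
    chart image is open. This turns open pieces of a cut into open plane sets. *)
Lemma cfun_open c (U : set S) : U `<=` cdom c -> open U -> open (cfun c @` U).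
Proof.
move=> Uc oU; rewrite openE => _ [p Up <-]; rewrite /interior.
have cp := Uc _ Up.
have /(cvg_cinv cp) : nbhs p U by exact: open_nbhs_nbhs.
move=> Uq; near=> q; exists (cinv c q); first by near: q.
have [p' cp' <-] : (cfun c @` cdom c) q by near: q; exact: near_cimg.
by rewrite cfunK.
Unshelve. all: by end_near. Qed.

Lemma smooth_differentiable (W : normedModType R) (u : S -> W) c p :
  smooth u -> atlas c -> cdom c p -> differentiable (u \o cinv c) (cfun c p).
Proof. by move=> su ac cp; have [+ _] := su c ac 1; apply; exists p. Qed.

Lemma smooth_continuous (W : normedModType R) (u : S -> W) :
  smooth u -> continuous u.
Proof.
move=> su p; have [c ac cp] := atlas_cover p.
have uc : {for p, continuous ((u \o cinv c) \o cfun c)}.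
  apply: continuous_comp (cfun_cont cp) _.
  exact/differentiable_continuous/smooth_differentiable.
apply: near_eq_continuous uc.
by apply: filterS (near_cdom cp) => p' cp'; rewrite /= cfunK.
Qed.

Lemma jacobian_continuous n (Y : S -> 'rV[R]_n) c p :
  smooth Y -> atlas c -> cdom c p ->
  {for cfun c p, continuous (fun q => 'J (Y \o cinv c) q)}.
Proof.
move=> sY ac cp; apply/continuous_mx => i j.
have JE p' : cdom c p' -> 'J (Y \o cinv c) (cfun c p') i j =
    ('D_(delta_mx 0 i) (Y \o cinv c) (cfun c p')) 0 j.
  by move=> cp'; rewrite -row_jacobian ?mxE//; exact: smooth_differentiable.
have Dc : {for cfun c p,
    continuous ('D_(delta_mx 0 i) (Y \o cinv c) : _ -> 'rV_n)}.
  (* Level 1 of [Ck] contains the continuity of every directional derivative. *)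
  have [_ /(_ (delta_mx 0 i))] := sY c ac 1.
  by move=> /(_ (cfun c p)); apply; exists p.
have /continuous_mx /(_ 0 j) Dj := Dc.
apply: near_eq_continuous Dj.
by apply: filterS (near_cimg cp) => _ [p' cp' <-]; exact/esym/JE.
Qed.

(** The chain rule: near [cfun c p], the map [Y \o cinv c] coincides with
    [(Y \o cinv d) \o transition c d]. Row vectors put the inner Jacobian on the left. *)
Lemma jacobian_transition n (Y : S -> 'rV[R]_n) c d p :
  smooth Y -> atlas c -> atlas d -> cdom c p -> cdom d p ->
  'J (Y \o cinv c) (cfun c p) =
  'J (transition c d) (cfun c p) *m 'J (Y \o cinv d) (cfun d p).
Proof.
move=> sY ac ad cp dp; have tp : transition c d (cfun c p) = cfun d p.
  by rewrite /transition/= cfunK.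
have dt : differentiable (transition c d) (cfun c p).
  by have [+ _] := atlas_smooth ac ad 1; apply; exists p.
have dYd : differentiable (Y \o cinv d) (transition c d (cfun c p)).
  by rewrite tp; exact: smooth_differentiable.
rewrite -tp; apply: etrans _ (jacobian_comp dt dYd).
apply: near_eq_jacobian.
- exact: smooth_differentiable.
- exact: (differentiable_comp dt dYd).
have near_d : \forall q \near cfun c p, cdom d (cinv c q).
  exact: cvg_cinv cp _ (near_cdom dp).
by apply: filterS near_d => q dq; rewrite /transition/= cfunK.
Qed.

End charts.

(** * Fundamental forms and |A|^2 of an immersed surface *)

Section immersed_surface.
Context {R : realType} {S : surface R} {X N : S -> 'rV[R]_3}.
Hypothesis immX : immersion X.
Hypothesis smoothN : smooth N.
Implicit Types (c d : chart R S) (p : S).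

Let smoothX : smooth X. Proof. by case: immX. Qed.

Let jacobian_free c p : atlas c -> cdom c p ->
  forall v : 'rV_2, v *m 'J (X \o cinv c) (cfun c p) = 0 -> v = 0.
Proof.
move=> ac cp v; rewrite /jacobian mul_rV_lin1 => dv0.
by case: immX => _ /(_ c p ac cp); apply; rewrite dv0 linear0.
Qed.

Lemma first_form_unitmx c p : atlas c -> cdom c p ->
  first_form X c (cfun c p) \in unitmx.
Proof. by move=> ac cp; exact/gram_unitmx/jacobian_free. Qed.

Lemma det_first_form_gt0 c p : atlas c -> cdom c p ->
  0 < \det (first_form X c (cfun c p)).
Proof. by move=> ac cp; exact/det_gram_gt0/jacobian_free. Qed.

Lemma first_form_continuous c p : atlas c -> cdom c p ->
  {for cfun c p, continuous (first_form X c)}.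
Proof.
move=> ac cp; have JX := jacobian_continuous smoothX ac cp.
exact: continuous_mulmx JX (continuous_trmx JX).
Qed.

Lemma second_form_continuous c p : atlas c -> cdom c p ->
  {for cfun c p, continuous (second_form X N c)}.
Proof.
move=> ac cp; have JX := jacobian_continuous smoothX ac cp.
have JN := jacobian_continuous smoothN ac cp.
exact: cvgN (continuous_mulmx JN (continuous_trmx JX)).
Qed.

(** Both fundamental forms change by congruence with the transition Jacobian, which preserves the
    trace. The choice [chart_at p] has no regularity in [p]; here it is replaced by any chart around
    [p]. *)
Lemma norm_shape_sqrE c p : atlas c -> cdom c p ->
  let g := first_form X c (cfun c p) in
  let h := second_form X N c (cfun c p) in
  norm_shape_sqr X N p = \tr (h *m invmx g *m h^T *m invmx g).
Proof.
move=> ac cp g h.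
have ad := chart_at_atlas p; have dp := chart_at_dom p.
set d := chart_at p in ad dp; set P := 'J (transition c d) (cfun c p).
have JX := jacobian_transition smoothX ac ad cp dp.
have JN := jacobian_transition smoothN ac ad cp dp.
have gE : g = P *m first_form X d (cfun d p) *m P^T.
  by rewrite /g /first_form JX trmx_mul !mulmxA.
have hE : h = P *m second_form X N d (cfun d p) *m P^T.
  by rewrite /h /second_form JX JN trmx_mul mulmxN mulNmx !mulmxA.
(* Invertibility of [P] is read off from that of [g], of which it is a factor. *)
have uP : P \in unitmx.
  have : g \in unitmx by exact: first_form_unitmx.
  by rewrite gE !unitmx_mul -andbA => /and3P[].
apply: mxtrace_adjoint_congr uP (first_form_unitmx ad dp) gE hE.
by rewrite trmx_mul trmxK.
Qed.

Lemma norm_shape_sqr_ge0 p : 0 <= norm_shape_sqr X N p.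
Proof.
have ap := chart_at_atlas p; have dp := chart_at_dom p.
rewrite (norm_shape_sqrE ap dp).
by apply: mxtrace_gram_form_ge0; exact: first_form_unitmx.
Qed.

Lemma norm_shape_sqr_continuous : continuous (norm_shape_sqr X N).
Proof.
move=> p; have [c ac cp] := atlas_cover p.
(* [T] is the formula in one fixed chart [c]; it computes |A|^2 at every point of the domain of
   [c]. *)
pose T q := let g := first_form X c q in let h := second_form X N c q in
  \tr (h *m invmx g *m h^T *m invmx g).
have Tq : {for cfun c p, continuous T}.
  have cg := first_form_continuous ac cp.
  have ch := second_form_continuous ac cp.
  have cgV := continuous_invmx (first_form_unitmx ac cp) cg.
  have chg := continuous_mulmx ch cgV.
  have chgh := continuous_mulmx chg (continuous_trmx ch).
  exact: continuous_mxtrace (continuous_mulmx chgh cgV).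
have Tp : {for p, continuous (T \o cfun c)}.
  by apply: continuous_comp Tq; exact: cfun_cont.
apply: near_eq_continuous Tp; apply: filterS (near_cdom cp) => p' cp'.
by apply: esym; exact: norm_shape_sqrE.
Qed.

End immersed_surface.

(** * Positivity of surface integrals *)

Section surface_integral.
Context {R : realType}.

(* Take the last index for which the first sets of the cut do not yet cover the
   surface: what they leave uncovered is open and equal to the piece. *)
Lemma cut_piece_open (S : surface R) (D : Defs.cut S) : [set: S] !=set0 ->
  exists i : 'I_(cut_size D), cut_piece i !=set0 /\ open (cut_piece i).
Proof.
move=> S0.
pose U k := ~` \bigcup_(j in [set j : 'I_(cut_size D) | (j < k)%N]) cut_set j.
have oU k : open (U k).
  apply/closed_openC/closed_bigcup; first exact: finite_finset.
  by move=> j _; exact/(compact_closed (@surface_hausdorff _ S))/cut_compact.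
have exU : exists k, `[< U k = set0 >].
  exists (cut_size D); apply/asboolP; rewrite -subset0 => p; apply.
  by have [i ip] := cut_cover D p; exists i => //=.
case: (ex_minnP exU) => -[/asboolP U0 _|m /asboolP Um1 minU].
  have [p _] := S0; suff : U 0 p by rewrite U0.
  by move=> [].
have Um0 : U m !=set0.
  apply/set0P/negP => /eqP/asboolP/minU; by rewrite ltnn.
have mD : (m < cut_size D)%N.
  rewrite ltnNge; apply/negP => Dm; have [p] := Um0; apply.
  have [i ip] := cut_cover D p; exists i => //=.
  exact: leq_trans (ltn_ord i) Dm.
suff piE : cut_piece (Ordinal mD) = U m.
  by exists (Ordinal mD); rewrite piE.
apply/seteqP; split=> [p []//|p Up]; split=> //.
apply: contrapT => Kp; suff : U m.+1 p by rewrite Um1.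
move=> [j /= jm jp]; move: jm; rewrite ltnS leq_eqVlt => /predU1P[jm|jm].
  by apply: Kp; rewrite (_ : Ordinal mD = j)//; exact/val_inj.
by apply: Up; exists j.
Qed.

Lemma compact_continuous_bounded (T : topologicalType) (K : set T)
    (g : T -> R) : compact K -> (forall p, K p -> {for p, continuous g}) ->
  exists M, forall p, K p -> g p <= M.
Proof.
move=> cK cg; have [->|/set0P K0] := eqVneq K set0; first by exists 0.
have [|c _ gc] := @compact_EVT_max T R g K K0 cK.
  by apply: continuous_in_subspaceT => p /[!inE]; exact: cg.
by exists (g c) => p Kp; apply: gc; rewrite inE.
Qed.

Lemma integral_surface_gt0 (S : compact_surface R) (X : S -> 'rV[R]_3)
    (F : S -> R) :
  [set: S] !=set0 -> immersion X -> continuous F -> (forall p, 0 < F p) ->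
  0 < integral_surface X F.
Proof.
move=> S0 immX cF F0; rewrite /integral_surface.
have [i [[p ip] oi]] := cut_piece_open (the_cut S) S0.
(* Only the open piece [i] has to contribute strictly; the remaining terms are integrals of
   nonnegative functions. *)
rewrite (bigD1 i)//= ltr_pwDl//; last first.
  apply: sumr_ge0 => j _; apply: Rintegral_ge0 => z [p' [jp' _] _].
  by rewrite mulr_ge0 ?sqrtr_ge0// ltW.
set c := cut_chart i; have ac : atlas c by exact: cut_atlas.
have ic : cut_piece i `<=` cdom c.
  by move=> p' [/cut_dom].
pose h q := F (cinv c q) * Num.sqrt (\det (first_form X c q)).
have h_cvg p' : cdom c p' -> {for cfun c p', continuous h}.
  move=> cp'.
  have h1 : {for cfun c p', continuous (F \o cinv c)}.
    by apply: continuous_comp; [exact: cinv_cont|exact: cF].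
  have h2 : {for cfun c p', continuous
      (Num.sqrt \o (fun q => \det (first_form X c q)))}.
    apply: continuous_comp; last exact: sqrt_continuous.
    exact: continuous_det (first_form_continuous immX ac cp').
  exact: cvgM h1 h2.
have h_gt0 p' : cdom c p' -> 0 < h (cfun c p').
  by move=> cp'; rewrite mulr_gt0// sqrtr_gt0 det_first_form_gt0.
have cKi : compact (cut_set i) by exact: cut_compact.
(* Both upper bounds are taken on the compact [cut_set i], which contains the piece and lies in the
   chart domain. *)
have [M KM] : exists M, forall p', cut_set i p' -> `|cfun c p'| <= M.
  apply: (compact_continuous_bounded (g := fun p' => `|cfun c p'|) cKi).
  move=> p' /cut_dom cp'.
  by apply: continuous_comp; [exact: cfun_cont|exact: norm_continuous].
have [b Kb] : exists b, forall p', cut_set i p' -> h (cfun c p') <= b.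
  apply: (compact_continuous_bounded (g := h \o cfun c) cKi).
  move=> p' /cut_dom cp'.
  by apply: continuous_comp; [exact: cfun_cont|exact: h_cvg].
have cp := ic _ ip.
(* Half of the value at [p] serves as lower bound: by continuity [h] stays above it near [cfun c p],
   and openness of the piece keeps these points in its image. *)
apply: (@integral_plane_gt0 _ _ (cfun c p) (h (cfun c p) / 2) b M).
- by move=> _ [p' [Kp' _] <-]; exact: KM.
- by rewrite divr_gt0// h_gt0.
- move=> _ [p' ip' <-]; rewrite (ltW (h_gt0 _ (ic _ ip')))/=.
  by case: ip' => Kp' _; exact: Kb.
- have hp : h (cfun c p) / 2 < h (cfun c p).
    by rewrite ltr_pdivrMr// ltr_pMr ?h_gt0// ltr1n.
  apply: filterI.
    apply: open_nbhs_nbhs; split; last by exists p.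
    exact: cfun_open.
  by apply: filterS (cvgr_gt _ (h_cvg _ cp) _ hp) => q /ltW.
Qed.

End surface_integral.

(** * Smoothness and drift Laplacian of constants *)

Section constant_function.
Context {R : realType}.

Lemma Ck_cst (V W : normedModType R) k (U : set V) (a : W) :
  Ck k U (cst a : V -> W).
Proof.
elim: k a => [|k IH] a /=; first by move=> x _; exact: cvg_cst.
split=> [x _|v]; first exact: differentiable_cst.
rewrite (_ : 'D_v (cst a) = cst 0)//.
by apply/funext => x; exact: derive_cst.
Qed.

Lemma partial_cst n (i : 'I_n) (a : R) :
  partial i (cst a : 'rV[R]_n -> R) = cst 0.
Proof. by apply/funext => x; exact: derive_cst. Qed.

Lemma drift_laplacian_cst (S : surface R) (f : 'rV[R]_3 -> R)
    (X : S -> 'rV[R]_3) (a : R) p : drift_laplacian f X (cst a) p = 0.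
Proof.
rewrite /drift_laplacian.
set c := chart_at p.
have -> : (cst a : S -> R) \o cinv c = cst a by [].
have hess0 : hessian (first_form X c) (cst a) (cfun c p) = 0.
  apply/matrixP => i j; rewrite !mxE partial_cst /= .
  rewrite big1 ?subr0 => [|k _]; last by rewrite partial_cst mulr0.
  by rewrite [partial i _]partial_cst.
have grad0 : grad (first_form X c) (cst a) (cfun c p) = 0.
  rewrite /grad (_ : \row_(i < _) _ = 0) ?mul0mx//.
  by apply/rowP => i; rewrite !mxE partial_cst.
rewrite /laplacian hess0 mulmx0 mxtrace0 grad0 /inner !mul0mx mxE subr0//.
Qed.

End constant_function.

(** * Curvature of the Gaussian space and the Jacobi operator on constants *)

Section gaussian_weight.
Context {R : realType}.

Lemma christoffel_euclidean n (k i j : 'I_n) :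
  christoffel (@euclidean R n) k i j = cst 0.
Proof.
apply/funext => x; rewrite /christoffel big1 ?mulr0// => l _.
have e0 (a b c : 'I_n) :
    partial a (fun y : 'rV[R]_n => euclidean y b c) x = 0.
  by rewrite (_ : (fun y => _) = cst (1%:M b c))// partial_cst.
by rewrite !e0 subr0 addr0 mulr0.
Qed.

Lemma ricci_euclidean n (x : 'rV[R]_n) : ricci (@euclidean R n) x = 0.
Proof.
apply/matrixP => i j; rewrite !mxE big1// => k _.
rewrite big1 => [|l _]; last by rewrite !christoffel_euclidean /= mulr0 subr0.
by rewrite !christoffel_euclidean !partial_cst subr0 addr0.
Qed.

Lemma is_derive_coord n (j : 'I_n) (x v : 'rV[R]_n) :
  is_derive x v (fun y : 'rV[R]_n => y 0 j) (v 0 j).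
Proof.
(* The coordinate is packed as a linear map, so that it is its own differential. *)
have @f : {linear 'rV[R]_n -> R}.
  by exists (fun y : 'rV[R]_n => y 0 j); do 2![eexists]; do ?[constructor];
    rewrite ?mxE// => ? *; rewrite ?mxE//; move=> ?; rewrite !mxE.
have cf : continuous f by exact: coord_continuous.
have df : differentiable f x by exact: linear_differentiable.
apply: (@DeriveDef _ _ _ x v f); first exact: diff_derivable.
by rewrite deriveE// diff_lin.
Qed.

(** An expression in the ring of functions, to which the derivation rules for sums, powers and
    scalings apply directly. *)
Lemma gaussian_weightE : @gaussian_weight R =
  4^-1 \*: (\sum_(i < 3) (fun x : 'rV[R]_3 => x 0 i) ^+ 2).
Proof.
apply/funext => x; rewrite /gaussian_weight /dot /inner mulmx1 mulrC mxE.
by rewrite /= fct_sumE; congr (_ * _); apply: eq_bigr => i _; rewrite mxE.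
Qed.

Lemma is_derive_gaussian_weight (x v : 'rV[R]_3) :
  is_derive x v (@gaussian_weight R)
    (4^-1 *: \sum_(i < 3) (2%:R * x 0 i) *: v 0 i).
Proof.
rewrite gaussian_weightE; apply: is_deriveZ; apply: is_derive_sum => i.
by have := is_deriveX 2 (is_derive_coord i x v); rewrite /= expr1.
Qed.

Lemma gaussian_weight_continuous : continuous (@gaussian_weight R).
Proof.
move=> x; have cid : {for x, continuous (id : 'rV[R]_3 -> 'rV[R]_3)}.
  exact: cvg_id.
have c1 : {for x, continuous (cst 1%:M : 'rV[R]_3 -> 'M[R]_3)}.
  apply: cst_continuous.
have cdot := continuous_mulmx (continuous_mulmx cid c1) (continuous_trmx cid).
have /continuous_mx /(_ 0 0) {}cdot := cdot.
by apply: cvgM cdot _; exact: cvg_cst.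
Qed.

Lemma partial_gaussian_weight (j : 'I_3) :
  partial j (@gaussian_weight R) = 2^-1 \*: (fun x : 'rV[R]_3 => x 0 j).
Proof.
apply/funext => x; rewrite /partial.
have [_ ->] := is_derive_gaussian_weight x (delta_mx 0 j).
rewrite (bigD1 j)//= big1 ?addr0 => [|i ij]; rewrite mxE eqxx/=; last first.
  by rewrite (negPf ij) scaler0.
rewrite eqxx [in LHS]/*:%R/= mulr1 mulrA.
by congr (_ * _); lra.
Qed.

(** The flat metric contributes neither Ricci curvature nor Christoffel symbols; what remains is the
    matrix of second partial derivatives of |x|^2/4. *)
Lemma ricci_weighted_gaussian (x : 'rV[R]_3) :
  ricci_weighted (@gaussian_weight R) x = 2^-1%:M.
Proof.
rewrite /ricci_weighted ricci_euclidean add0r.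
apply/matrixP => i j; rewrite !mxE big1 ?subr0 => [|k _]; last first.
  by rewrite christoffel_euclidean mul0r.
rewrite partial_gaussian_weight /partial.
have [_ ->] := is_deriveZ 2^-1 (is_derive_coord j x (delta_mx 0 i)).
by rewrite mxE eqxx /= eq_sym; exact: mulr_natr.
Qed.

Lemma jacobi_gaussian_cst (S : surface R) (X N : S -> 'rV[R]_3) (a : R) p :
  dot (N p) (N p) = 1 ->
  jacobi (@gaussian_weight R) X N (cst a) p = (norm_shape_sqr X N p + 2^-1) * a.
Proof.
move=> NN; rewrite /jacobi drift_laplacian_cst add0r ricci_weighted_gaussian.
rewrite /inner mul_mx_scalar -scalemxAl mxE.
by rewrite /dot /inner mulmx1 in NN; rewrite NN mulr1.
Qed.

End gaussian_weight.

(** * Instability from the constant test function *)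

Unset Implicit Arguments.

Theorem corollary1p4 (R : realType) (S : compact_surface R)
    (X N : S -> 'rV[R]_3) :
  [set: S] !=set0 ->
  oriented S ->
  immersion X ->
  unit_normal X N ->
  (exists H0 : R,
     forall p, weighted_mean_curvature (@gaussian_weight R) X N p = H0) ->
  unstable (@gaussian_weight R) X N.
Proof.
move=> S0 _ immX [sN NN _] _.
have cX : continuous X by case: immX => /smooth_continuous.
have cE : continuous (fun p => expR (- gaussian_weight (X p))).
  move=> p; apply: (@continuous_comp _ _ _ (fun p => - gaussian_weight (X p)) expR);
    last exact: continuous_expR.
  apply: (@cvgN _ R^o).
  by apply: continuous_comp (cX p) _; exact: gaussian_weight_continuous.
have E_gt0 p : 0 < expR (- gaussian_weight (X p)) by exact: expR_gt0.
(* The first eigenvalue is an infimum, so one negative quotient contradicts stability. *)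
suff : rayleigh (@gaussian_weight R) X N (cst 1) < 0.
  rewrite ltNge => /negP ray0 st; apply: ray0; rewrite -lee_fin.
  apply: le_trans st _; apply: ereal_inf_lbound; exists (cst 1) => //; split.
    by move=> c _ k; exact: Ck_cst.
  (* Nonemptiness makes [cst 1] differ from the zero function: they are compared at a point. *)
  have [p _] := S0 => /(congr1 (@^~ p)) /eqP; by rewrite /= oner_eq0.
(* With the sign pulled out, numerator and denominator are both integrals of positive continuous
   functions. *)
rewrite /rayleigh mulNr oppr_lt0 divr_gt0//; apply: integral_surface_gt0 => //.
- rewrite (_ : (fun p => _) = fun p => (norm_shape_sqr X N p + 2^-1) *
      expR (- gaussian_weight (X p))); last first.
    by apply/funext => p; rewrite jacobi_gaussian_cst// mul1r mulr1.
  move=> p; apply: cvgM (cE p); apply: cvgD; last exact: cvg_cst.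
  exact: norm_shape_sqr_continuous.
- move=> p; rewrite jacobi_gaussian_cst// mul1r mulr1 mulr_gt0//.
  (* The term 1/2 from the Hessian of the weight gives strict positivity even where A vanishes. *)
  by rewrite ltr_wpDl ?invr_gt0// norm_shape_sqr_ge0.
- rewrite (_ : (fun p => _) = fun p => expR (- gaussian_weight (X p)))//.
  by apply/funext => p; rewrite expr1n mul1r.
- by move=> p; rewrite expr1n mul1r.
Qed.
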